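(* There exists a numerical constant $L>0$ with the following property. Let $T\subset\mathbb{R}_0^d$ and suppose $X_1,\ldots,X_d$ are non-negative i.i.d. random variables such that the function $N(t):=-\ln\mathbf{P}(X_i\ge t)$ is convex. Then there exists a countable set $\mathcal{G}\subset\mathbb{R}^d$ for which $$\Big\{x\in\mathbb{R}^d:\ \sup_{t\in T}\sum_{i=1}^d x(i)t_i\ \ge\ L\,\mathbf{E}\sup_{t\in T}\sum_{i=1}^d X_it_i\Big\}\ \subset\ \bigcup_{w\in\mathcal{G}}\{x\in\mathbb{R}^d:\ \langle x,w\rangle\ge 1\}$$ and $$\sum_{w\in\mathcal{G}}\mathbf{P}\big(\langle (X_1,\ldots,X_d),w\rangle\ge 1\big)\ \le\ \tfrac12 .$$
   Context: $\mathbb{R}_0=[0,\infty)$; $x(i)$ denotes the $i$-th coordinate of $x\in\mathbb{R}^d$ (coordinates of $t\in T$ are written $t_i$); $\langle\cdot,\cdot\rangle$ is the standard scalar product on $\mathbb{R}^d$.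
   Formalization: The formal theorem additionally assumes that the expected supremum E sup_{t∈T} Σ X_i t_i is strictly positive and finite; otherwise (e.g. T={0}, T empty, or T unbounded in a coordinate with X_i not a.s. zero) the claim fails. *)

(* Defs.v *)
From HB Require Import structures.
From mathcomp Require Import all_boot all_order all_algebra.
From mathcomp Require Import all_classical all_reals all_analysis.

Set Implicit Arguments.
Unset Strict Implicit.
Unset Printing Implicit Defensive.

Import Order.TTheory GRing.Theory Num.Theory.
Import numFieldNormedType.Exports.

Local Open Scope classical_set_scope.
Local Open Scope ring_scope.

Definition dotp (R : realType) (d : nat) (x y : 'rV[R]_d) : R :=
  \sum_(i < d) x ord0 i * y ord0 i.

(* Extended-real valued; equal to -oo when T is empty. *)
Definition sup_dotp (R : realType) (d : nat) (T : set 'rV[R]_d)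
    (x : 'rV[R]_d) : \bar R :=
  ereal_sup [set (dotp x t)%:E | t in T].

(* The library's [convex_function] only covers real-valued functions; here f
   may take the value +oo, and 0 * +oo = 0 in [\bar R]. *)
Definition econvex_on (R : realType) (D : set R) (f : R -> \bar R) : Prop :=
  forall (l x y : R), 0 <= l <= 1 -> D x -> D y ->
    (f (l * x + (1 - l) * y)%R <= l%:E * f x + (1 - l)%:E * f y)%E.

Section random_variables.
Variables (disp : measure_display) (Omega : measurableType disp) (R : realType).
Variable P : probability Omega R.

(* N(t) = - ln P(Y >= t), with value +oo when P(Y >= t) = 0. *)
Definition neg_log_tail (Y : {RV P >-> R}) (t : R) : \bar R :=
  (- lne (P [set om | (t <= Y om)%R]))%E.

Variable d : nat.

Definition mutually_independent (X : 'I_d -> {RV P >-> R}) : Prop :=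
  forall (J : {set 'I_d}) (A : 'I_d -> set R),
    (forall i, measurable (A i)) ->
    P (\bigcap_(i in [set i | i \in J]) (X i @^-1` A i)) =
    (\prod_(i in J) P (X i @^-1` A i))%E.

(* The laws are compared on Borel sets only: P is a total function whose
   values on non-measurable sets carry no meaning. *)
Definition identically_distributed (X : 'I_d -> {RV P >-> R}) : Prop :=
  forall (i j : 'I_d) (A : set R), measurable A ->
    distribution P (X i) A = distribution P (X j) A.

Definition iid (X : 'I_d -> {RV P >-> R}) : Prop :=
  mutually_independent X /\ identically_distributed X.

Definition rvec (X : 'I_d -> {RV P >-> R}) (om : Omega) : 'rV[R]_d :=
  \row_(i < d) X i om.

Definition expected_sup (X : 'I_d -> {RV P >-> R}) (T : set 'rV[R]_d)
  : \bar R := (\int[P]_om sup_dotp T (rvec X om))%E.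

End random_variables.

(* Main.v *)
Require Import Defs.
From HB Require Import structures.
From mathcomp Require Import all_boot all_order all_algebra.
From mathcomp Require Import all_classical all_reals all_analysis.
From mathcomp Require Import measurable_realfun ring lra.

Set Implicit Arguments.
Unset Strict Implicit.
Unset Printing Implicit Defensive.

Import Order.TTheory GRing.Theory Num.Theory.
Import numFieldNormedType.Exports HBNNSimple.

Local Open Scope classical_set_scope.
Local Open Scope ring_scope.

(** Rounding the coordinates to dyadic levels turns the event into one about
    finite patterns [r], where the orthant of points above a fixed multiple
    of [r] lies in a half-space of probability [exp (- kappa N(r))], [N] being
    the sum of the [- ln P(X >= level)].  So it suffices to find, for every
    pattern [s] of large weight, a subpattern [r] from a family over which
    [exp (- kappa N(r))] has a small sum.

    Such a family is read off a typical sample [W] of the process, by an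
    encoding argument: [r] must be recoverable, up to exp(O(N(r))) choices,
    from the overlay [Z] of [r] on [W].  To this end [r] maximises
    [sup_t score_v(t, Z) - 4 N(r) / v], where a coordinate of weight [c] and
    cost [N] scores [c + c N / (N + v c)].  As [v] goes from 0 to infinity the
    maximum grows from twice the weight of [W], which is small, to the weight
    of [s], which is large, so it increases strictly between some [v] and
    [2 v].  The score itself decreases in [v], most of all at the coordinates
    whose efficiency [c / N] is at least [1 / v], so an increase forces the
    total cost of the efficient coordinates of [Z] to be O(N(r)), while
    optimality puts the support of [r] among them. *)

(** * Efficiency scores *)

Section score.
Context {R : realType}.
Implicit Types v c N : R.

(** For positive arguments the second term is the inverse of [1 / c + v / N], comparable to the
    smaller of [c] and [N / v]. The score thus falls from [2 * c] towards [c] as [v] grows, the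
    transition being at [v] of order [N / c]. *)
Definition coord_score v c N : R := c + c * N / (N + v * c).

Lemma coord_score0 v : coord_score v 0 0 = 0.
Proof. by rewrite /coord_score !mul0r addr0. Qed.

Lemma coord_score_ge v c N : 0 <= v -> 0 <= c -> 0 <= N ->
  c <= coord_score v c N.
Proof.
move=> v0 c0 N0; rewrite lerDl mulr_ge0 ?invr_ge0 ?addr_ge0 ?mulr_ge0//.
Qed.

Lemma coord_score_le v c N : 0 <= v -> 0 <= c -> 0 <= N ->
  coord_score v c N <= 2 * c.
Proof.
move=> v0 c0 N0; rewrite /coord_score mulr_natl mulr2n lerD2l.
have [s0|s0] := eqVneq (N + v * c) 0; first by rewrite s0 invr0 mulr0.
have sp : 0 < N + v * c by rewrite lt_neqAle eq_sym s0 addr_ge0// mulr_ge0.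
rewrite ler_pdivrMr// ler_wpM2l// lerDl mulr_ge0//.
Qed.

Lemma coord_score_anti v c N : 0 < v -> 0 <= c -> 0 < N ->
  coord_score (2 * v) c N <= coord_score v c N.
Proof.
move=> v0 c0 N0; rewrite /coord_score lerD2l.
apply: ler_wpM2l; first by rewrite mulr_ge0 // ltW.
have vc : 0 <= v * c by rewrite mulr_ge0// ltW.
rewrite lef_pV2 ?posrE; nra.
Qed.

(* With x = 2 v c / N, the decrease is (N / 2 v) x^2 / ((2 + x) (1 + x)), and
   the last factor is at least 1/6 as soon as x >= 1. *)
Lemma coord_score_drop v c N : 0 < v -> 0 < N -> N <= 2 * v * c ->
  N / (12 * v) <= coord_score v c N - coord_score (2 * v) c N.
Proof.
move=> v0 N0 Nc.
have vc : 0 < v * c by nra.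
have -> : coord_score v c N - coord_score (2 * v) c N =
    N / (12 * v) * (12 * (v * c) ^+ 2 / ((N + v * c) * (N + 2 * (v * c)))).
  rewrite /coord_score; field.
  by rewrite !gt_eqF//; nra.
rewrite ler_peMr//; first by rewrite ltW // divr_gt0 // mulr_gt0.
rewrite ler_pdivlMr; [nra|apply: mulr_gt0; nra].
Qed.

End score.

(** * Existence of fragments *)

Section fragments.
Context {R : realType} {d n : nat}.
Notation pattern := {ffun 'I_d -> 'I_n.+1}.
Variables (val cost : 'I_n.+1 -> R).
Implicit Types (r s z W : pattern) (t : 'I_d -> R).

Definition pattern_cost r : R := \sum_i cost (r i).

Definition weight t z : R := \sum_i t i * val (z i).

Definition overlay W r : pattern := [ffun i => if r i == ord0 then W i else r i].

Definition subpattern r s : bool := [forall i, (r i == ord0) || (r i == s i)].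

Definition score v t z : R :=
  \sum_i coord_score v (t i * val (z i)) (cost (z i)).

Variables (B : R) (T : set ('I_d -> R)).

(** Normalised so that [4 / scale 0 = 2 * B]: at the first scale the penalty per unit of cost
    matches the largest possible score. *)
Definition scale (j : nat) : R := 2 / B * 2 ^+ j.

(** The supremum over [T] need not be attained; the tolerance is a small multiple of [1 / scale j],
    below what the cheapest coordinate is charged. The choice depends on [z] alone, so that it can
    be recomputed from an overlay. *)
Definition near_maximizer (tau : nat -> pattern -> 'I_d -> R) :=
  forall j z, T (tau j z) /\ forall t, T t ->
    score (scale j) t z <= score (scale j) (tau j z) z + 8^-1 / 2 ^+ j.

(** As [scale j.+1 = 2 * scale j], the threshold is the hypothesis of [coord_score_drop] at
    [v = scale j]. *)
Definition efficient (tau : nat -> pattern -> 'I_d -> R) j z : {set 'I_d} :=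
  [set i | (z i != ord0) &&
           (cost (z i) <= scale j.+1 * (tau j.+1 z i * val (z i)))].

(** The first two clauses leave few possible supports of [r] once the overlay is known; the third
    makes the sums over [j] converge. *)
Definition fragment tau j W r : bool :=
  let z := overlay W r in
  [&& [forall i, (r i != ord0) ==> (i \in efficient tau j z)],
      \sum_(i in efficient tau j z) cost (z i) <= 24 * pattern_cost r
    & j.+1%:R <= 8 * B * pattern_cost r].

Hypotheses (B_ge1 : 1 <= B) (val0 : val ord0 = 0) (cost0 : cost ord0 = 0)
  (cost_ge1 : forall l, l != ord0 -> 1 <= cost l)
  (val_ge0 : forall l, 0 <= val l)
  (T_ge0 : forall t, T t -> forall i, 0 <= t i)
  (T_bound : forall t, T t -> forall i l, t i * val l <= B * cost l).

Let B_gt0 : 0 < B. Proof. exact: lt_le_trans B_ge1. Qed.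

Lemma cost_ge0 l : 0 <= cost l.
Proof.
by have [->|/cost_ge1/(le_trans ler01)//] := eqVneq l ord0; rewrite cost0.
Qed.

Lemma pattern_cost_ge0 r : 0 <= pattern_cost r.
Proof. by apply: sumr_ge0 => i _; exact: cost_ge0. Qed.

Lemma scale_gt0 j : 0 < scale j.
Proof. by rewrite mulr_gt0 ?divr_gt0 ?exprn_gt0. Qed.

Lemma scaleS j : scale j.+1 = 2 * scale j.
Proof. by rewrite /scale exprS mulrCA. Qed.

Let tval_ge0 t i l : T t -> 0 <= t i * val l.
Proof. by move=> Tt; rewrite mulr_ge0 ?T_ge0. Qed.

Lemma score_ge_weight v t z : T t -> 0 <= v -> weight t z <= score v t z.
Proof.
by move=> Tt v0; apply: ler_sum => i _; rewrite coord_score_ge ?tval_ge0 ?cost_ge0.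
Qed.

Lemma score_le v t z : T t -> 0 <= v -> score v t z <= 2 * B * pattern_cost z.
Proof.
move=> Tt v0; rewrite mulr_sumr; apply: ler_sum => i _.
apply: (le_trans (coord_score_le _ _ _)); rewrite ?tval_ge0 ?cost_ge0//.
by rewrite -mulrA ler_wpM2l ?T_bound.
Qed.

Lemma near_maximizer_exists : T !=set0 -> exists tau, near_maximizer tau.
Proof.
move=> [t0 Tt0].
have H (jz : nat * pattern) : exists t, T t /\ forall t', T t' ->
    score (scale jz.1) t' jz.2 <= score (scale jz.1) t jz.2 + 8^-1 / 2 ^+ jz.1.
  case: jz => j z /=.
  pose A := [set score (scale j) t z | t in T].
  have ubA : has_sup A.
    split; first by exists (score (scale j) t0 z), t0.
    exists (2 * B * pattern_cost z) => _ [t Tt <-].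
    by rewrite score_le// ltW// scale_gt0.
  have eps : 0 < 8^-1 / 2 ^+ j :> R by rewrite divr_gt0 ?exprn_gt0.
  have [_ [t Tt <-] supA] := sup_adherent eps ubA.
  exists t; split=> // t' Tt'.
  rewrite -lerBlDr; apply: le_trans (ltW supA); rewrite lerD2r.
  by apply: ub_le_sup; [case: ubA|exists t'].
have [f Hf] := choice H.
by exists (fun j z => f (j, z)) => j z; exact: (Hf (j, z)).
Qed.

Section fragment_exists.
Variables (tau : nat -> pattern -> 'I_d -> R) (W s : pattern) (t0 : 'I_d -> R).
Hypotheses (tauP : near_maximizer tau)
  (W_le : forall t, T t -> weight t W <= 4)
  (Tt0 : T t0) (s_ge : 10 <= weight t0 s).

Let objective j r : R :=
  score (scale j) (tau j (overlay W r)) (overlay W r)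
  - 4 / scale j * pattern_cost r.

Let Ttau j z : T (tau j z). Proof. by case: (tauP j z). Qed.

(** At scale 0 the penalty [2 * B] per unit of cost cancels whatever the coordinates of [r] score,
    which leaves at most twice the weight of [W]. *)
Lemma objective0_le r : objective 0 r <= 8.
Proof.
rewrite /objective; set z := overlay W r; set t := tau 0 z.
have Tt : T t by exact: Ttau.
apply: (@le_trans _ _ (2 * weight t W)); last by have := W_le Tt; lra.
rewrite /score /pattern_cost !mulr_sumr -sumrB; apply: ler_sum => i _.
have s0 : 4 / scale 0 = 2 * B.
  by rewrite /scale expr0 mulr1; field; rewrite gt_eqF.
have -> : 4 / scale 0 = 2 * B by [].
have /ltW sp := scale_gt0 0.
rewrite /z /overlay ffunE; case: eqP => [->|_].
  rewrite cost0 mulr0 subr0.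
  by rewrite coord_score_le ?tval_ge0 ?cost_ge0.
have := coord_score_le sp (tval_ge0 i (r i) Tt) (cost_ge0 (r i)).
have := T_bound Tt i (r i); have := tval_ge0 i (W i) Tt; nra.
Qed.

(** For large [J] the penalty of [s] is at most 1/2 and the tolerance at most 1/8, against a weight
    of at least 10. *)
Lemma objective_large : exists j, 9 < objective j s.
Proof.
have B0 := ltW B_gt0; have p0 := pattern_cost_ge0 s.
have x0 : 0 <= 4 * B * pattern_cost s by rewrite !mulr_ge0.
have [J hJ] : exists J, 4 * B * pattern_cost s <= 2 ^+ J.
  exists (Num.truncn (4 * B * pattern_cost s)).+1.
  apply: (@le_trans _ _ (Num.truncn (4 * B * pattern_cost s)).+1%:R).
    by have /andP[_ /ltW] := truncn_itv x0.
  by rewrite -natrX ler_nat ltnW// ltn_expl.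
exists J; have eJ : (2 ^+ J : R) >= 1 by rewrite exprn_ege1// ler1n.
have Jp : 0 < 2 ^+ J :> R by exact: lt_le_trans eJ.
rewrite /objective; set z := overlay W s.
have [Tt /(_ _ Tt0) le1] := tauP J z.
have le2 : weight t0 s <= weight t0 z.
  apply: ler_sum => i _; rewrite /z /overlay ffunE.
  by case: eqP => // ->; rewrite val0 mulr0 tval_ge0.
have le3 := score_ge_weight z Tt0 (ltW (scale_gt0 J)).
have le4 : 8^-1 / 2 ^+ J <= 8^-1 :> R.
  by rewrite ler_pdivrMr//; lra.
have le5 : 4 / scale J * pattern_cost s <= 2^-1.
  have -> : 4 / scale J = 2 * B / 2 ^+ J.
    by rewrite /scale; field; rewrite !gt_eqF.
  by rewrite mulrAC ler_pdivrMr//; lra.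
have le6 := le_trans s_ge (le_trans le2 (le_trans le3 (le_trans le1 (lerD (lexx _) le4)))).
lra.
Qed.

Let best : {f : nat -> pattern | forall j, subpattern (f j) s /\
  forall r, subpattern r s -> objective j r <= objective j (f j)}.
Proof.
apply: cid.
have ss : subpattern s s by apply/forallP => i; rewrite eqxx orbT.
suff H j : exists r', subpattern r' s /\
    forall r, subpattern r s -> objective j r <= objective j r'.
  by have [f fP] := choice H; exists f.
have [r Pr maxr] := @arg_maxP _ _ _ s (subpattern^~ s) (objective j) ss.
exists r; split; first exact: Pr.
by move=> r' r's; exact: maxr.
Qed.

(** The increments [(j + 1) / (4 * 2 ^ j)] sum to 1, so without a jump the maximum could not pass
    from 8 to above 9. *)
Lemma objective_jump : exists j,
  objective j (sval best j) + 4^-1 * j.+1%:R / 2 ^+ j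
    < objective j.+1 (sval best j.+1).
Proof.
case: best => f fP /=; apply: contrapT => /forallNP H.
(* The subtracted term is the sum of the increments from [j] onwards. *)
have M j : objective j (f j) <= 9 - 4^-1 * (2 * j%:R + 4) / 2 ^+ j.
  elim: j => [|j IH].
    by rewrite expr0; apply: le_trans (objective0_le _) _; lra.
  have /negP := H j; rewrite -leNgt => /le_trans; apply.
  apply: le_trans (lerD IH (lexx _)) _.
  rewrite exprS invfM -!(natr1 j); move: ((2 ^+ j : R)^-1) (j%:R : R) => e x; lra.
have [j hj] := objective_large.
have [_ /(_ s)] := fP j.
have -> : subpattern s s by apply/forallP => i; rewrite eqxx orbT.
move=> /(_ isT) /le_trans /(_ (M j)).
have : 0 <= 4^-1 * (2 * j%:R + 4) / 2 ^+ j :> R.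
  by rewrite !mulr_ge0 ?invr_ge0 ?exprn_ge0 ?addr_ge0 ?mulr_ge0.
lra.
Qed.

(** The fragment is the optimal subpattern just after the jump, compared at the scale before it with
    the optimum there. *)
Lemma fragment_exists : exists j r, subpattern r s && fragment tau j W r.
Proof.
have [j] := objective_jump; case: best => f fP /= jump.
have [rs rmax] := fP j.+1; have [_ /(_ _ rs) rle] := fP j.
exists j, (f j.+1); rewrite rs /=; move: rs rmax rle jump.
set r := f j.+1; set z := overlay W r; set v := scale j => rs rmax rle jump.
have v0 : 0 < v := scale_gt0 j.
have vS : scale j.+1 = 2 * v := scaleS j.
set t := tau j.+1 z; have Tt : T t by exact: Ttau.
have e0 : 0 < (2 ^+ j)^-1 :> R by rewrite invr_gt0 exprn_gt0.
have vB : v * B = 2 * 2 ^+ j by rewrite /v /scale; field; rewrite gt_eqF.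
have v2 : v / 2 ^+ j = 2 / B.
  by rewrite /v /scale mulfK// gt_eqF// exprn_gt0.
(* Here [t] is nearly optimal at scale [2 * v] and a mere competitor at scale [v]. Half of the jump
   absorbs the tolerance; the right side is the decrease of the penalty from [4 / v] to [2 / v] per
   unit of cost. *)
have key : score v t z - score (2 * v) t z + 8^-1 * j.+1%:R / 2 ^+ j
    <= 2 / v * pattern_cost r.
  have [_ /(_ _ Tt) le1] := tauP j z.
  move: rle jump; rewrite /objective -/z -/t -/v vS.
  have -> : 4 / (2 * v) = 2 / v by field; rewrite gt_eqF.
  have -> : 4 / v = 2 / v + 2 / v by field; rewrite gt_eqF.
  move: le1; rewrite -/v => le1 rle jump.
  have : 8^-1 / 2 ^+ j <= 8^-1 * j.+1%:R / 2 ^+ j :> R.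
    by apply: ler_wpM2r; [exact: ltW|rewrite ler_peMr ?ler1n].
  lra.
have dropge i : 0 <= coord_score v (t i * val (z i)) (cost (z i))
     - coord_score (2 * v) (t i * val (z i)) (cost (z i)).
  rewrite subr_ge0; have [->|/cost_ge1 c1] := eqVneq (z i) ord0.
    by rewrite val0 cost0 mulr0 !coord_score0.
  by rewrite coord_score_anti ?tval_ge0//; lra.
have drop_ge0 : 0 <= score v t z - score (2 * v) t z.
  by rewrite /score -sumrB sumr_ge0.
apply/and3P; split.
- apply/forallP => i; apply/implyP => ri.
  have zi : z i = r i by rewrite /z /overlay ffunE (negbTE ri).
  rewrite inE zi ri /= vS -/t leNgt; apply/negP => small.
  (* Erasing an inefficient coordinate saves twice [cost (r i) / v] in penalty and loses at most
     [cost (r i) / v] in score. Near optimality then puts [cost (r i) / v] below the tolerance,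
     hence the cost below 1. *)
  pose r' : pattern := [ffun k => if k == i then ord0 else r k].
  have r's : subpattern r' s.
    apply/forallP => k; rewrite ffunE; case: ifP => // _.
    by have /forallP/(_ k) := rs.
  have := rmax _ r's; rewrite /objective -/z -/t vS.
  set z' := overlay W r'.
  have [_ /(_ _ Tt)] := tauP j.+1 z'; rewrite vS => le1.
  have costr : pattern_cost r = cost (r i) + pattern_cost r'.
    rewrite /pattern_cost (bigD1 i)//= [in RHS](bigD1 i)//= ffunE eqxx cost0 add0r.
    by congr (_ + _); apply: eq_bigr => k /negbTE ki; rewrite ffunE ki.
  have le2 : score (2 * v) t z <=
      coord_score (2 * v) (t i * val (r i)) (cost (r i)) + score (2 * v) t z'.
    rewrite /score (bigD1 i)//= [in leRHS](bigD1 i)//= zi lerD2l.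
    have -> : \sum_(k | k != i) coord_score (2 * v) (t k * val (z k)) (cost (z k))
        = \sum_(k | k != i) coord_score (2 * v) (t k * val (z' k)) (cost (z' k)).
      by apply: eq_bigr => k /negbTE ki; rewrite /z /z' /overlay !ffunE ki.
    rewrite lerDr (le_trans (tval_ge0 i (z' i) Tt))// coord_score_ge ?tval_ge0 ?cost_ge0//.
    by rewrite mulr_ge0// ltW.
  have v20 : 0 <= 2 * v by rewrite mulr_ge0// ltW.
  have le3 := coord_score_le v20 (tval_ge0 i (r i) Tt) (cost_ge0 (r i)).
  have {}le3 : coord_score (2 * v) (t i * val (r i)) (cost (r i))
      <= cost (r i) / v.
    apply: le_trans le3 _.
    by rewrite ler_pdivlMr//; lra.
  have -> : 4 / (2 * v) = 2 / v by field; rewrite gt_eqF.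
  rewrite costr => le4.
  have le5 : cost (r i) / v <= 8^-1 / 2 ^+ j.+1.
    have : 2 / v * (cost (r i) + pattern_cost r') =
      2 * (cost (r i) / v) + 2 / v * pattern_cost r' by ring.
    lra.
  have := cost_ge1 ri; move: le5; rewrite ler_pdivrMr// exprS invfM.
  have -> : 8^-1 * (2^-1 / 2 ^+ j) * v = 16^-1 * (v / 2 ^+ j) by field; rewrite gt_eqF// exprn_gt0.
  rewrite v2 => le6 le7.
  have : 2 / B <= 2 by rewrite ler_pdivrMr// ler_peMr.
  lra.
(* Efficient coordinates drop by at least [cost / (12 * v)] and no coordinate rises; with [key] this
   gives the factor 24. *)
- have le1 : (\sum_(i in efficient tau j z) cost (z i)) / (12 * v)
      <= score v t z - score (2 * v) t z.
    rewrite mulr_suml /score -sumrB [leRHS](bigID (mem (efficient tau j z)))/=.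
    rewrite -[leLHS]addr0 lerD//; last by apply: sumr_ge0.
    apply: ler_sum => i; rewrite inE vS => /andP[zi eff].
    by rewrite coord_score_drop// ?mulrA//; have := cost_ge1 zi; lra.
  have le2 : 0 <= 8^-1 * j.+1%:R / 2 ^+ j :> R.
    by rewrite !mulr_ge0// ltW.
  have : (\sum_(i in efficient tau j z) cost (z i)) / (12 * v)
      <= 2 / v * pattern_cost r by lra.
  have v12 : 0 < 12 * v by rewrite mulr_gt0 // v0.
  rewrite ler_pdivrMr// => /le_trans; apply.
  by rewrite le_eqVlt; apply/orP; left; apply/eqP; field; rewrite gt_eqF.
- have : 8^-1 * j.+1%:R / 2 ^+ j <= 2 / v * pattern_cost r by lra.
  rewrite ler_pdivrMr ?exprn_gt0// -ler_pdivlMl ?invr_gt0// invrK.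
  move=> /le_trans; apply.
  have -> : 2 / v = B / 2 ^+ j.
    by rewrite /v /scale; field; rewrite !gt_eqF ?exprn_gt0.
  rewrite le_eqVlt; apply/orP; left; apply/eqP.
  by field; rewrite gt_eqF ?exprn_gt0.
Qed.

End fragment_exists.
End fragments.

(** * Counting fragments *)

Lemma ler_sum_inj (R : realType) (I J : finType) (P : pred I) (Q : pred J)
    (h : I -> J) (F : I -> R) (G : J -> R) :
  injective h -> (forall i, P i -> Q (h i) /\ F i <= G (h i)) ->
  (forall j, Q j -> 0 <= G j) ->
  \sum_(i | P i) F i <= \sum_(j | Q j) G j.
Proof.
move=> inj PQ G0.
apply: (@le_trans _ _ (\sum_(i | P i) G (h i))).
  by apply: ler_sum => i /PQ[].
rewrite -(big_imset (A := P) G)/=; last by move=> x y _ _; exact: inj.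
rewrite [leRHS](bigID (fun j => j \in h @: P))/=.
rewrite -[leLHS]addr0 lerD ?sumr_ge0//; last by move=> j /andP[/G0].
rewrite le_eqVlt; apply/orP; left; apply/eqP/eq_bigl => j.
apply/idP/idP => [/[dup] jP /imsetP[i Pi ->]|/andP[]//].
by rewrite (PQ _ Pi).1 imset_f.
Qed.

Section counting.
Context {R : realType} {d n : nat}.
Notation pattern := {ffun 'I_d -> 'I_n.+1}.
Variables (val cost mu : 'I_n.+1 -> R) (B : R).
Variable tau : nat -> pattern -> 'I_d -> R.
Implicit Types (r z W : pattern) (D : {set 'I_d}).

Hypotheses (cost0 : cost ord0 = 0)
  (cost_ge1 : forall l, l != ord0 -> 1 <= cost l)
  (mu_ge0 : forall l, 0 <= mu l) (mu_sum : \sum_l mu l = 1)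
  (mu_ge : forall l, l != ord0 -> expR (- (2 * cost l)) <= mu l).

(** The rate is spent as [2 + 24 + 32 * B]: on the masses of the levels of [r], on the choice of its
    support, and on a factor [16^-1] per scale. *)
Definition cover_rate : R := 26 + 32 * B.

Let A := efficient val cost B tau.
Let M z : R := \prod_i mu (z i).
Let restricted_cost z D : R := \sum_(i in D) cost (z i).
(** The clauses of [fragment], read on the code of [r]: its overlay and its support. *)
Let admissible j (p : pattern * {set 'I_d}) : bool :=
  [&& p.2 \subset A j p.1,
      restricted_cost p.1 (A j p.1) <= 24 * restricted_cost p.1 p.2
    & j.+1%:R <= 8 * B * restricted_cost p.1 p.2].
Let agree W (p : pattern * {set 'I_d}) : bool :=
  [forall i, (i \in p.2) || (W i == p.1 i)].

Let M_ge0 z : 0 <= M z. Proof. exact: prodr_ge0. Qed.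

Lemma sum_pattern_mass : \sum_z M z = 1.
Proof.
rewrite -(bigA_distr_bigA (fun (_ : 'I_d) l => mu l))/=.
by rewrite big1.
Qed.

(** The code determines [r]: on the support the overlay displays [r], and elsewhere [r] is [ord0].
    Off the support the overlay agrees with [W]. *)
Lemma fragment_sum_le j W :
  \sum_(r | fragment val cost B tau j W r)
      expR (- (cover_rate * pattern_cost cost r))
  <= \sum_(p | admissible j p && agree W p)
      expR (- (cover_rate * restricted_cost p.1 p.2)).
Proof.
pose h r : pattern * {set 'I_d} := (overlay W r, [set i | r i != ord0]%SET).
apply: (@ler_sum_inj _ _ _ _ (fun p => admissible j p && agree W p) h _
  (fun p => expR (- (cover_rate * restricted_cost p.1 p.2)))) => [r r' [e1 e2]|r|p _]; last exact: expR_ge0.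
  apply/ffunP => i; move/setP/(_ i): e2; rewrite !inE => e2.
  move/ffunP/(_ i): e1; rewrite !ffunE.
  move: e2; case: (r i =P ord0) => [->|_]; case: (r' i =P ord0) => [->|_] //.
have supp : restricted_cost (overlay W r) [set i | r i != ord0]%SET = pattern_cost cost r.
  rewrite /pattern_cost [RHS](bigID (fun i => r i != ord0))/= [X in _ + X]big1.
    rewrite addr0; apply: eq_big => [i|i]; rewrite inE// => /negbTE ri.
    by rewrite /overlay ffunE ri.
  by move=> i; rewrite negbK => /eqP ->.
move=> /and3P[/forallP e1 e2 e3]; rewrite /h /admissible /= !supp lexx; split=> //.
apply/andP; split.
  apply/and3P; split=> //.
  by apply/fintype.subsetP => i; rewrite inE => ri; have := e1 i; rewrite ri.
by apply/forallP => i; rewrite inE /overlay ffunE; case: eqP => //= _; exact: eqxx.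
Qed.

Lemma sum_agree (p : pattern * {set 'I_d}) :
  \sum_(W | agree W p) M W <= \prod_i (if i \in p.2 then 1 else mu (p.1 i)).
Proof.
have -> : \sum_(W | agree W p) M W =
    \prod_i \sum_(l | (i \in p.2) || (l == p.1 i)) mu l.
  rewrite (bigA_distr_big_dep (fun i l => (i \in p.2) || (l == p.1 i))
    (fun _ l => mu l))/=.
  apply: eq_bigl => W.
  by apply/forallP/familyP => H i; have := H i; rewrite ?inE.
apply: ler_prod => i _; rewrite sumr_ge0//=.
case: ifP => ip /=; first by rewrite mu_sum.
by rewrite big_pred1_eq.
Qed.

(** The agreement fixes [W] off [D]; the share [2] of the rate supplies the missing masses on [D],
    completing [M p.1]. Efficient coordinates cost at least 1, so the share [24] beats the number of
    subsets of the efficient set, and [32 * B * N >= 4 * (j + 1)] gives the last factor. *)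
Lemma sum_admissible_mass j (p : pattern * {set 'I_d}) : admissible j p ->
  expR (- (cover_rate * restricted_cost p.1 p.2)) * \sum_(W | agree W p) M W
  <= M p.1 * ((2 ^+ #|A j p.1|)^-1 * 16^-1 ^+ j.+1).
Proof.
case: p => z D /and3P[/=]; set N := restricted_cost z D => DA NA jN.
have Anz i : i \in A j z -> z i != ord0 by rewrite inE => /andP[].
have le1 : expR (- (2 * N)) <= \prod_(i in D) mu (z i).
  rewrite /N /restricted_cost mulr_sumr -sumrN expR_sum; apply: ler_prod => i iD.
  by rewrite expR_ge0 mu_ge// Anz// (fintype.subsetP DA).
have le2 : expR (- (2 * N)) * (\sum_(W | agree W (z, D)) M W) <= M z.
  have -> : M z = (\prod_(i in D) mu (z i)) * \prod_(i | i \notin D) mu (z i).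
    by rewrite /M (bigID (mem D)).
  apply: ler_pM; rewrite ?expR_ge0 ?sumr_ge0//.
  apply: le_trans (sum_agree _) _; rewrite /= (bigID (mem D))/= big1 ?mul1r.
    by rewrite le_eqVlt; apply/orP; left; apply/eqP/eq_bigr => i /negbTE ->.
  by move=> i ->.
have le3 : expR (- (24 * N)) <= (2 ^+ #|A j z|)^-1.
  rewrite expRN lef_pV2 ?posrE ?expR_gt0 ?exprn_gt0//.
  apply: (@le_trans _ _ (expR (restricted_cost z (A j z)))); last by rewrite ler_expR.
  rewrite /restricted_cost expR_sum -prodr_const; apply: ler_prod => i /Anz/cost_ge1 c1.
  by rewrite ler0n /=; apply: le_trans (expR_ge1Dx _); lra.
have le4 : expR (- (32 * B * N)) <= 16^-1 ^+ j.+1.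
  have e4 : expR (- 4) <= 16^-1 :> R.
    rewrite expRN lef_pV2 ?posrE ?expR_gt0//.
    rewrite -[4]mulr1 expRM_natl; have -> : 16 = 2 ^+ 4 :> R by rewrite -natrX.
    by rewrite lerXn2r ?nnegrE ?expR_ge0//; apply: le_trans (expR_ge1Dx _).
  apply: (@le_trans _ _ (expR (- 4) ^+ j.+1)).
    by rewrite -expRM_natl ler_expR; lra.
  by rewrite lerXn2r ?nnegrE ?expR_ge0// invr_ge0.
have -> : - (cover_rate * N) = - (2 * N) + (- (24 * N) + - (32 * B * N)).
  by rewrite /cover_rate; ring.
rewrite expRD mulrAC expRD.
apply: ler_pM => //; first by rewrite mulr_ge0 ?expR_ge0 ?sumr_ge0.
by apply: ler_pM; rewrite ?expR_ge0.
Qed.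

(** After exchanging sums, [W] is summed for a fixed code. The power of 2 then cancels the number of
    sets [D], and the masses of the overlays add up to 1. *)
Lemma sum_fragment_level j :
  \sum_W M W * \sum_(r | fragment val cost B tau j W r)
      expR (- (cover_rate * pattern_cost cost r)) <= 16^-1 ^+ j.+1.
Proof.
apply: (@le_trans _ _ (\sum_W \sum_(p | admissible j p && agree W p)
    M W * expR (- (cover_rate * restricted_cost p.1 p.2)))).
  by apply: ler_sum => W _; rewrite -mulr_sumr ler_wpM2l ?fragment_sum_le.
rewrite (exchange_big_dep (admissible j))/=; last by move=> W p _ /andP[].
apply: (@le_trans _ _ (\sum_(p | admissible j p)
    M p.1 * ((2 ^+ #|A j p.1|)^-1 * 16^-1 ^+ j.+1))).
  apply: ler_sum => p adm; apply: le_trans (sum_admissible_mass adm).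
  rewrite le_eqVlt; apply/orP; left; apply/eqP.
  by rewrite [RHS]mulr_sumr; apply: eq_big => [W|W _]; rewrite ?adm// mulrC.
have le1 : \sum_(p | admissible j p) M p.1 * ((2 ^+ #|A j p.1|)^-1 * 16^-1 ^+ j.+1)
    <= \sum_z \sum_(D : {set 'I_d} | D \subset A j z)
         M z * ((2 ^+ #|A j z|)^-1 * 16^-1 ^+ j.+1).
  rewrite pair_big_dep/= [leRHS](bigID (admissible j))/=.
  rewrite -[leLHS]addr0 lerD//.
    rewrite le_eqVlt; apply/orP; left; apply/eqP; apply: eq_bigl => p.
    by rewrite /admissible; case: (_ \subset _).
  apply: sumr_ge0 => p _; rewrite !mulr_ge0 ?invr_ge0 ?exprn_ge0 ?invr_ge0//.
apply: le_trans le1 _.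
apply: (@le_trans _ _ ((\sum_z M z) * 16^-1 ^+ j.+1)); last first.
  by rewrite sum_pattern_mass mul1r.
rewrite mulr_suml; apply: ler_sum => z _.
under eq_bigl => D do rewrite -powersetE.
rewrite sumr_const card_powerset -mulrnAr ler_wpM2l//.
by rewrite -[leLHS]mulr_natl natrX [leLHS]mulrA mulfV ?mul1r// gt_eqF// exprn_gt0.
Qed.

Lemma sum_fragments J :
  \sum_W M W * \sum_(r | [exists j : 'I_J, fragment val cost B tau j W r])
      expR (- (cover_rate * pattern_cost cost r)) <= 8^-1.
Proof.
apply: (@le_trans _ _ (\sum_(j < J) 16^-1 ^+ j.+1)); last first.
  suff -> : \sum_(j < J) 16^-1 ^+ j.+1 = 15^-1 * (1 - 16^-1 ^+ J) :> R.
    have : 0 <= 16^-1 ^+ J :> R by rewrite exprn_ge0// invr_ge0.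
    lra.
  elim: J => [|J IH]; first by rewrite big_ord0 expr0 subrr mulr0.
  by rewrite big_ord_recr/= IH exprS; move: (16^-1 ^+ J) => e; field.
apply: (@le_trans _ _ (\sum_(j < J) \sum_W M W *
    \sum_(r | fragment val cost B tau j W r)
      expR (- (cover_rate * pattern_cost cost r)))); last first.
  by apply: ler_sum => j _; exact: sum_fragment_level.
rewrite exchange_big/=; apply: ler_sum => W _.
rewrite -mulr_sumr ler_wpM2l// (exchange_big_dep predT)//= big_mkcond/=.
apply: ler_sum => r _; case: ifP => [/existsP[j fj]|_].
  by rewrite (bigD1 j)//= lerDl sumr_ge0// => *; exact: expR_ge0.
by rewrite sumr_ge0// => *; exact: expR_ge0.
Qed.

End counting.

(** * A cover read off one good sample *)

Section pattern_cover.
Context {R : realType} {d n : nat}.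
Notation pattern := {ffun 'I_d -> 'I_n.+1}.

(** Averaging: if every good sample gave a sum above 1/4, the mean would be at least 3/16, whereas
    [sum_fragments] bounds it by 1/8. *)
Lemma pattern_cover (val cost mu : 'I_n.+1 -> R) (B : R) (T : set ('I_d -> R))
    (good : pred pattern) :
  1 <= B -> val ord0 = 0 -> cost ord0 = 0 ->
  (forall l, l != ord0 -> 1 <= cost l) ->
  (forall l, 0 <= val l) ->
  (forall t, T t -> forall i, 0 <= t i) ->
  (forall t, T t -> forall i l, t i * val l <= B * cost l) ->
  (forall l, 0 <= mu l) -> \sum_l mu l = 1 ->
  (forall l, l != ord0 -> expR (- (2 * cost l)) <= mu l) ->
  T !=set0 ->
  (forall W t, good W -> T t -> weight val t W <= 4) ->
  3 / 4 <= \sum_(W : pattern | good W) \prod_i mu (W i) ->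
  exists G : pred pattern,
    [/\ forall s t, T t -> 10 <= weight val t s ->
          exists2 r, G r & subpattern r s,
        forall r, G r -> 0 < pattern_cost cost r
      & \sum_(r | G r) expR (- (cover_rate B * pattern_cost cost r)) <= 4^-1].
Proof.
move=> B1 v0 c0 c1 vge Tge Tb mu0 mus muge Tne Wle gW.
have [tau tauP] := near_maximizer_exists B1 c0 c1 vge Tge Tb Tne.
have N0 (r : pattern) := pattern_cost_ge0 c0 c1 r.
have B0 : 0 < B by exact: lt_le_trans B1.
(* The third clause of [fragment] bounds [j] by the cost, so all fragments occur at scales below
   [J]. *)
pose J := (Num.truncn (8 * B * \sum_(r : pattern) pattern_cost cost r)).+1.
pose G W r := [exists j : 'I_J, fragment val cost B tau j W r].
pose S W := \sum_(r | G W r) expR (- (cover_rate B * pattern_cost cost r)).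
have [W [gdW SW]] : exists W, good W /\ S W <= 4^-1.
  apply: contrapT => /forallNP H.
  have := sum_fragments val B tau c0 c1 mu0 mus muge J.
  apply/negP; rewrite -ltNge.
  apply: (@lt_le_trans _ _ (3 / 4 * 4^-1)); first by lra.
  apply: (@le_trans _ _ ((\sum_(W : pattern | good W) \prod_i mu (W i)) * 4^-1)).
    by rewrite ler_wpM2r.
  rewrite mulr_suml big_mkcond/=; apply: ler_sum => W _.
  have p0 : 0 <= \prod_i mu (W i) by apply: prodr_ge0.
  case: ifP => gdW; last by rewrite mulr_ge0// sumr_ge0.
  rewrite ler_wpM2l// ltW// ltNge; apply/negP => SW.
  exact: H (conj gdW SW).
exists (G W); split=> // [s t Tt ts|r /existsP[j /and3P[_ _]] jN].
  have Wl t' : T t' -> weight val t' W <= 4 by exact: Wle.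
  have [j [r /andP[rs fr]]] :=
    fragment_exists B1 v0 c0 c1 vge Tge Tb tauP Wl Tt ts.
  exists r => //; have jJ : (j < J)%N.
    rewrite -(ltr_nat R); have /and3P[_ _ jN] := fr.
    apply: lt_le_trans (_ : j.+1%:R <= _); first by rewrite ltr_nat.
    apply: le_trans jN _.
    apply: (@le_trans _ _ (8 * B * \sum_(r : pattern) pattern_cost cost r)).
      apply: ler_wpM2l; first by rewrite mulr_ge0// ltW.
      by rewrite (bigD1 r)//= lerDl sumr_ge0.
    have : 0 <= 8 * B * \sum_(r : pattern) pattern_cost cost r.
      by rewrite mulr_ge0 ?sumr_ge0// mulr_ge0// ltW.
    by move=> /truncn_itv/andP[_ /ltW].
  by apply/existsP; exists (Ordinal jJ).
rewrite lt_neqAle N0 andbT eq_sym; apply/eqP => r0.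
by move: jN; rewrite r0 mulr0 leNgt ltr0n.
Qed.

End pattern_cover.

(** * Finite mixtures of indicators *)

Section finite_mixtures.
Context {disp : measure_display} {Omega : measurableType disp} {R : realType}.
Variable P : probability Omega R.

Definition pr (A : set Omega) : R := fine (P A).

Lemma prE A : measurable A -> P A = (pr A)%:E.
Proof. by move=> mA; rewrite /pr fineK// fin_num_measure. Qed.

Lemma pr_ge0 A : 0 <= pr A.
Proof. by rewrite fine_ge0. Qed.

Lemma pr_setT : pr setT = 1.
Proof. by rewrite /pr probability_setT. Qed.

(* No measurability is needed: the integral is a lower integral. *)
Lemma integral_mono (f g : Omega -> \bar R) :
  (forall x, (0 <= f x)%E) -> (forall x, (f x <= g x)%E) ->
  (\int[P]_x f x <= \int[P]_x g x)%E.
Proof.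
move=> f0 fg; rewrite !ge0_integralTE//; last by move=> x; exact: le_trans (fg x).
apply: le_ereal_sup => _ [h hf <-]; exists h => // x.
exact: le_trans (fg x).
Qed.

Lemma integral_finite_mixture (K : finType) (Q : pred K) (c : K -> R)
    (A : K -> set Omega) :
  (forall k, 0 <= c k) -> (forall k, measurable (A k)) ->
  (\int[P]_x (\sum_(k | Q k) c k * \1_(A k) x)%:E
   = (\sum_(k | Q k) c k * pr (A k))%:E)%E.
Proof.
move=> c0 mA.
under eq_integral do rewrite -sumEFin -big_filter.
rewrite ge0_integral_sum//=.
- rewrite -sumEFin big_filter; apply: eq_bigr => k _.
  under eq_integral do rewrite EFinM.
  rewrite ge0_integralZl ?lee_fin//=.
    by rewrite integral_indic// setIT EFinM; congr (_ * _)%E; exact: prE.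
  by apply/measurable_EFinP; exact: measurable_indic.
- move=> k; apply/measurable_EFinP; apply: measurable_funM => //.
- by move=> k x _; rewrite lee_fin mulr_ge0.
Qed.

(** Serves for Markov-type bounds on a supremum over an uncountable set, whose measurability is not
    known. *)
Lemma finite_mixture_le_integral (K : finType) (Q : pred K) (c : K -> R)
    (A : K -> set Omega) (f : Omega -> \bar R) :
  (forall k, 0 <= c k) -> (forall k, measurable (A k)) ->
  (forall x, (\sum_(k | Q k) c k * \1_(A k) x)%:E <= f x)%E ->
  ((\sum_(k | Q k) c k * pr (A k))%:E <= \int[P]_x f x)%E.
Proof.
move=> c0 mA le_f; rewrite -integral_finite_mixture//.
by apply: integral_mono => // x; rewrite lee_fin sumr_ge0// => k _; rewrite mulr_ge0.
Qed.

Lemma pr_union_bound (K : finType) (Q : pred K) (A : K -> set Omega)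
    (S : set Omega) :
  measurable S -> (forall k, measurable (A k)) ->
  (forall x, S x -> exists2 k, Q k & A k x) ->
  pr S <= \sum_(k | Q k) pr (A k).
Proof.
move=> mS mA SA; rewrite -lee_fin -(prE mS) -[X in (P X)]setIT -integral_indic//.
rewrite -(eq_bigr _ (fun k _ => mul1r (pr (A k)))) -integral_finite_mixture//.
apply: integral_mono => x; rewrite lee_fin//.
rewrite indicE; case: (boolP (x \in S)) => xS /=; last by rewrite sumr_ge0// => k _; rewrite mulr_ge0.
have [k Qk Ak] := SA x (set_mem xS).
by rewrite (bigD1 k)//= indicE mem_set// mulr1 lerDl sumr_ge0// => i _.
Qed.

Lemma pr_mono (A B : set Omega) : measurable A -> measurable B ->
  A `<=` B -> pr A <= pr B.
Proof.
move=> mA mB AB; rewrite -lee_fin -!prE//.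
by apply: le_measure; rewrite ?inE.
Qed.

Lemma pr_le1 A : measurable A -> pr A <= 1.
Proof. by move=> mA; rewrite -pr_setT pr_mono. Qed.

End finite_mixtures.

(** * Dyadic levels *)

Section dyadic_levels.
Context {R : realType}.
Variables (n : nat) (a : R).

(* The number, capped at n, of thresholds a, 2 a, 4 a, ... below x. *)
Definition level (x : R) : 'I_n.+1 :=
  inord (find (fun k => x < a * 2 ^+ k) (iota 0 n)).

(** Thresholds are numbered from 0, so a positive level [l] starts at threshold [l.-1]; level 0 is
    rounded down to 0. *)
Definition level_value (l : 'I_n.+1) : R :=
  if l == ord0 then 0 else a * 2 ^+ l.-1.

Lemma level_value0 : level_value ord0 = 0.
Proof. by rewrite /level_value eqxx. Qed.

Lemma levelE x : level x = find (fun k => x < a * 2 ^+ k) (iota 0 n) :> nat.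
Proof. by rewrite inordK// ltnS -[X in (_ <= X)%N](size_iota 0 n) find_size. Qed.

Lemma level_le_threshold x k : (k < level x)%N -> a * 2 ^+ k <= x.
Proof.
rewrite levelE => kf; rewrite leNgt -[k in 2 ^+ k]add0n -(nth_iota 0 0 (n := n)).
  by rewrite (before_find 0 kf).
by apply: leq_trans kf _; rewrite -[leqRHS](size_iota 0 n) find_size.
Qed.

Lemma level_lt_threshold x : (level x < n)%N -> x < a * 2 ^+ level x.
Proof.
rewrite levelE => fn.
have hf : has (fun k => x < a * 2 ^+ k) (iota 0 n) by rewrite has_find size_iota.
by have := nth_find 0 hf; rewrite nth_iota.
Qed.

Lemma level_lt_top x : x < a * 2 ^+ n -> x < a * 2 ^+ level x.
Proof.
move=> xn; have : (level x <= n)%N by rewrite -ltnS ltn_ord.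
by rewrite leq_eqVlt => /predU1P[->//|/level_lt_threshold].
Qed.

Lemma level_value_le x : 0 <= x -> level_value (level x) <= x.
Proof.
move=> x0; rewrite /level_value; case: eqP => // /eqP l0.
by apply: level_le_threshold; rewrite prednK// lt0n.
Qed.

Hypothesis a_gt0 : 0 < a.

Lemma level_value_gt0 l : l != ord0 -> 0 < level_value l.
Proof. by rewrite /level_value => /negbTE ->; rewrite mulr_gt0 ?exprn_gt0. Qed.

Lemma level_value_ge0 l : 0 <= level_value l.
Proof.
by have [->|/level_value_gt0/ltW//] := eqVneq l ord0; rewrite level_value0.
Qed.

Lemma levelP x l : level x = l <->
  ((l == ord0) || (level_value l <= x)) && ((l == n :> nat) || (x < a * 2 ^+ l)).
Proof.
split=> [<-|].
  apply/andP; split.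
    rewrite /level_value; case: eqP => //= /eqP l0.
    by apply: level_le_threshold; rewrite prednK// lt0n.
  have : (level x <= n)%N by rewrite -ltnS ltn_ord.
  by rewrite leq_eqVlt => /predU1P[->|/level_lt_threshold ->]; rewrite ?eqxx ?orbT.
move=> /andP[h1 h2]; apply/val_inj => /=; apply/eqP; rewrite eqn_leq; apply/andP; split.
  rewrite leqNgt; apply/negP => lf.
  have ln : (l < n)%N by apply: leq_trans lf _; rewrite -ltnS ltn_ord.
  move: h2; rewrite (ltn_eqF ln)/= ltNge => /negP; apply.
  exact: level_le_threshold.
rewrite leqNgt; apply/negP => fl.
have l0 : l != ord0 by apply: contraTneq fl => ->.
have fn : (level x < n)%N by apply: leq_trans fl _; rewrite -ltnS ltn_ord.
move: h1; rewrite (negbTE l0)/= /level_value (negbTE l0) leNgt => /negP; apply.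
apply: lt_le_trans (level_lt_threshold fn) _.
rewrite ler_wpM2l ?(ltW a_gt0)// ler_eXn2l ?ltr1n//.
by rewrite -ltnS prednK// (leq_ltn_trans _ fl).
Qed.

Lemma measurable_level l : measurable [set x | level x = l].
Proof.
have -> : [set x | level x = l] =
    (if l == ord0 then setT else [set x | level_value l <= x]) `&`
    (if l == n :> nat then setT else [set x | x < a * 2 ^+ l]).
  apply/seteqP; split=> x /=.
    by move=> /levelP/andP[]; do 2 case: ifP.
  move=> h; apply/levelP; move: h.
  by do 2 case: ifP => _ /=; case=> h1 h2; rewrite ?h1 ?h2.
apply: measurableI; case: ifP => _ //.
  by rewrite -set_itvcy; exact: measurable_itv.
by rewrite -set_itvNyo; exact: measurable_itv.
Qed.

End dyadic_levels.

(** * An exponential estimate for integer vectors *)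

(** A Chernoff bound: half of the exponent is traded for the constraint, the other half factors into
    geometric series of ratio at most 2/3, with sums at most [3 <= expR (2 * c i)]. Coordinates with
    [c i = 0] are frozen and contribute 1. *)
Lemma capped_geometric_sum (R : realType) (d M : nat) (c : 'I_d -> R) (K : R) :
  (forall i, c i = 0 \/ 1 <= c i) ->
  \sum_(j : {ffun 'I_d -> 'I_M.+1} |
      [forall i, (c i == 0) ==> (j i == ord0)] &&
      (K * (\sum_i c i) <= \sum_i c i * (j i)%:R))
    \prod_i expR (- (c i * (j i)%:R))
  <= expR (- ((K / 2 - 2) * \sum_i c i)).
Proof.
move=> c01; set N := \sum_i c i.
have c0 i : 0 <= c i by case: (c01 i) => [->//|/(le_trans ler01)].
pose F i (l : 'I_M.+1) := expR (- (c i * l%:R / 2)).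
have F0 i l : 0 <= F i l by exact: expR_ge0.
apply: (@le_trans _ _ (\sum_(j : {ffun 'I_d -> 'I_M.+1} |
    [forall i, (c i == 0) ==> (j i == ord0)]) expR (- (K * N / 2)) * \prod_i F i (j i))).
  rewrite [leRHS](bigID (fun j : {ffun 'I_d -> 'I_M.+1} =>
    K * N <= \sum_i c i * (j i)%:R))/=.
  rewrite -[leLHS]addr0 lerD//; last first.
    by apply: sumr_ge0 => j _; rewrite mulr_ge0 ?expR_ge0// prodr_ge0.
  apply: ler_sum => j /andP[_ Kj].
  have -> : \prod_i expR (- (c i * (j i)%:R)) =
      expR (- ((\sum_i c i * (j i)%:R) / 2)) * \prod_i F i (j i).
    rewrite -!expR_sum -expRD; congr expR.
    by rewrite mulr_suml -!sumrN -big_split/=; apply: eq_bigr => i _; lra.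
  by rewrite ler_wpM2r ?prodr_ge0// ler_expR; lra.
rewrite -mulr_sumr.
have -> : - ((K / 2 - 2) * N) = - (K * N / 2) + 2 * N by lra.
rewrite expRD ler_wpM2l ?expR_ge0//.
have -> : \sum_(j : {ffun 'I_d -> 'I_M.+1} |
    [forall i, (c i == 0) ==> (j i == ord0)]) \prod_i F i (j i) =
    \prod_i \sum_(l | (c i == 0) ==> (l == ord0)) F i l.
  rewrite (bigA_distr_big_dep (fun i l => (c i == 0) ==> (l == ord0)) F)/=.
  apply: eq_bigl => j.
  by apply/forallP/familyP => H i; have := H i; rewrite ?inE.
rewrite mulr_sumr expR_sum; apply: ler_prod => i _; rewrite sumr_ge0//=.
case: (c01 i) => [->|c1].
  rewrite eqxx/= big_pred1_eq /F; rewrite ?mulr0 ?mul0r.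
  by rewrite !(mulr0, mul0r, oppr0).
rewrite gt_eqF/=; last by lra.
apply: (@le_trans _ _ 3); last by apply: le_trans (expR_ge1Dx _); lra.
apply: (@le_trans _ _ (\sum_(l < M.+1) (2 / 3) ^+ l)).
  apply: ler_sum => l _; rewrite /F.
  have e : expR (- 2^-1) <= 2 / 3 :> R.
    rewrite expRN -[leRHS]invrK lef_pV2 ?posrE ?expR_gt0// ?invr_gt0//.
    by apply: le_trans (expR_ge1Dx _); lra.
  apply: (@le_trans _ _ (expR (- 2^-1) ^+ l)); last first.
    by rewrite lerXn2r ?nnegrE ?expR_ge0.
  rewrite -expRM_natl ler_expR.
  have : l%:R <= c i * l%:R :> R by rewrite ler_peMl.
  lra.
suff -> : \sum_(l < M.+1) (2 / 3) ^+ l = 3 * (1 - (2 / 3) ^+ M.+1) :> R.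
  have : 0 <= (2 / 3) ^+ M.+1 :> R by rewrite exprn_ge0.
  lra.
elim: M.+1 => [|m IH]; first by rewrite big_ord0 expr0 subrr mulr0.
by rewrite big_ord_recr/= IH exprS; move: ((2 / 3) ^+ m) => e; lra.
Qed.

(** * Independent variables with log-concave tails *)

Section independent_family.
Context {disp : measure_display} {Omega : measurableType disp} {R : realType}.
Variables (P : probability Omega R) (d : nat) (X : 'I_d -> {RV P >-> R}).

Lemma measurable_preimage (Y : {RV P >-> R}) (A : set R) :
  measurable A -> measurable (Y @^-1` A).
Proof. by move=> mA; rewrite -[X in measurable X]setTI; exact: measurable_funP. Qed.

Lemma measurable_ge (x : R) : measurable [set y : R | x <= y].
Proof. by rewrite -set_itvcy; exact: measurable_itv. Qed.

Lemma measurable_box (A : 'I_d -> set R) : (forall i, measurable (A i)) ->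
  measurable [set om | forall i, A i (X i om)].
Proof.
move=> mA; have -> : [set om | forall i, A i (X i om)] =
    \bigcap_(i in [set: 'I_d]) (X i @^-1` A i).
  by apply/seteqP; split=> om /= H i *; exact: H.
apply: fin_bigcap_measurable => [|i _]; last exact: measurable_preimage.
exact: finite_finset.
Qed.

Lemma pr_box (A : 'I_d -> set R) : mutually_independent X ->
  (forall i, measurable (A i)) ->
  pr P [set om | forall i, A i (X i om)] = \prod_i pr P (X i @^-1` A i).
Proof.
move=> indX mA; have := indX [set: 'I_d]%SET A mA.
have -> : \bigcap_(i in [set i | i \in [set: 'I_d]%SET]) (X i @^-1` A i) =
    [set om | forall i, A i (X i om)].
  apply/seteqP; split=> om /= H i; first by apply: (H i); rewrite /= inE.
  by move=> _; exact: H.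
rewrite prE; last exact: measurable_box.
rewrite (eq_bigr (fun i => (pr P (X i @^-1` A i))%:E)); last first.
  by move=> i _; rewrite prE//; exact: measurable_preimage.
rewrite prodEFin => -[->]; apply: eq_bigl => i; by rewrite inE.
Qed.

Lemma measurable_halfspace (w : 'rV[R]_d) :
  measurable [set om | 1 <= dotp (rvec X om) w].
Proof.
have mf : measurable_fun setT (fun om => dotp (rvec X om) w).
  apply: measurable_sum => i; apply: measurable_funM; last exact: measurable_cst.
  by under eq_fun do rewrite mxE; exact: measurable_funP.
have := mf measurableT _ (measurable_ge 1); rewrite setTI; exact.
Qed.

(** On the half-space the sum of [c i * X i / v i] is at least [K] times the total cost. Rounding
    each [X i / v i] down to an integer loses at most one total cost, and independence bounds the
    probability of each resulting box. *)
Lemma pr_halfspace (c v : 'I_d -> R) (K : R) :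
  mutually_independent X -> (forall i om, 0 <= X i om) -> 1 <= K ->
  (forall i, c i = 0 \/ 1 <= c i /\ 0 < v i) ->
  (forall i (j : nat), c i != 0 ->
     pr P [set om | j%:R * v i <= X i om] <= expR (- (c i * j%:R))) ->
  0 < \sum_i c i ->
  pr P [set om | 1 <= dotp (rvec X om)
                        (\row_i (c i / (K * v i * \sum_k c k)))]
  <= expR (- (((K - 1) / 2 - 2) * \sum_i c i)).
Proof.
move=> indX X0 K1 cv tail; set N := \sum_i c i => N0.
have c0 i : 0 <= c i by case: (cv i) => [->//|[/(le_trans ler01)]].
(* The cap leaves finitely many boxes; since [c i >= 1], a single coordinate at the cap meets the
   constraint by itself. *)
have [M hM] : exists M : nat, (K - 1) * N <= M%:R.
  exists (Num.truncn ((K - 1) * N)).+1.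
  have : 0 <= (K - 1) * N by apply: mulr_ge0; rewrite ?subr_ge0// ltW.
  by move=> /truncn_itv/andP[_ /ltW].
have c01 i : c i = 0 \/ 1 <= c i by case: (cv i) => [|[]]; [left|right].
apply: le_trans (capped_geometric_sum M (K - 1) c01).
pose box (j : {ffun 'I_d -> 'I_M.+1}) i : set R :=
  [set y | (if c i == 0 then 0 else (j i)%:R * v i) <= y].
have mbox j i : measurable (box j i) by exact: measurable_ge.
apply: (@le_trans _ _ (\sum_(j : {ffun 'I_d -> 'I_M.+1} |
      [forall i, (c i == 0) ==> (j i == ord0)] &&
      ((K - 1) * N <= \sum_i c i * (j i)%:R))
    pr P [set om | forall i, box j i (X i om)])); last first.
  apply: ler_sum => j _; rewrite pr_box//; apply: ler_prod => i _.
  rewrite pr_ge0/=; have [ci0|ci0] := eqVneq (c i) 0.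
    by rewrite ci0 mul0r oppr0 expR0 pr_le1//; exact: measurable_preimage.
  have := tail i (j i) ci0; rewrite /box (negbTE ci0); exact.
apply: pr_union_bound => [|j|om].
- exact: measurable_halfspace.
- exact: measurable_box.
move=> /= half; set y := fun i => X i om / v i.
pose f i : nat := minn (Num.truncn (y i)) M.
pose j : {ffun 'I_d -> 'I_M.+1} := [ffun i => if c i == 0 then ord0 else inord (f i)].
have jE i : c i != 0 -> j i = f i :> nat.
  by move=> /negbTE ci; rewrite ffunE ci inordK// ltnS geq_minr.
have y0 i : c i != 0 -> 0 <= y i.
  move=> ci; case: (cv i) => [/eqP|[_ vi]]; first by rewrite (negbTE ci).
  by rewrite divr_ge0// ltW.
exists j; last first.
  move=> i; rewrite /box /=; case: ifP => [//|/negbT ci].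
  case: (cv i) => [/eqP|[_ vi]]; first by rewrite (negbTE ci).
  rewrite -ler_pdivlMr// -/(y i) jE//.
  apply: (@le_trans _ _ (Num.truncn (y i))%:R); first by rewrite ler_nat geq_minl.
  by have /andP[] := truncn_itv (y0 i ci).
apply/andP; split.
  by apply/forallP => i; apply/implyP => ci; rewrite ffunE ci.
have cj0 i : 0 <= c i * (j i)%:R by rewrite mulr_ge0.
have [[i [ci hi]]|none] :=
    pselect (exists i, c i != 0 /\ (M < Num.truncn (y i))%N).
  apply: le_trans hM _; apply: (@le_trans _ _ (c i * (j i)%:R)).
    rewrite jE// /f (minn_idPr (ltnW hi)) ler_peMl//.
    by case: (cv i) => [/eqP|[]//]; rewrite (negbTE ci).
  by rewrite (bigD1 i)//= lerDl sumr_ge0.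
have big : K * N <= \sum_i c i * y i.
  have : 1 * (K * N) <= dotp (rvec X om) (\row_i (c i / (K * v i * N))) * (K * N).
    by apply: ler_wpM2r => //; rewrite mulr_ge0 ?ltW//; lra.
  rewrite mul1r => /le_trans; apply; rewrite /dotp mulr_suml; apply: ler_sum => i _.
  rewrite !mxE /y; case: (cv i) => [->|[ci vi]]; first by rewrite !(mulr0, mul0r).
  rewrite le_eqVlt; apply/orP; left; apply/eqP; field.
  by rewrite !gt_eqF//; lra.
apply: (@le_trans _ _ (\sum_i (c i * y i - c i))).
  by rewrite sumrB -/N; lra.
apply: ler_sum => i _; have [->|ci] := eqVneq (c i) 0.
  by rewrite !mul0r subrr.
have hi : (Num.truncn (y i) <= M)%N.
  by rewrite leqNgt; apply/negP => hi; apply: none; exists i.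
rewrite jE// /f (minn_idPl hi) -[X in _ - X]mulr1 -mulrBr ler_wpM2l//.
by have /andP[_] := truncn_itv (y0 i ci); rewrite -natr1; lra.
Qed.

End independent_family.

(** * Decay of a log-concave tail *)

Section log_concave_tail.
Context {disp : measure_display} {Omega : measurableType disp} {R : realType}.
Variables (P : probability Omega R) (Y : {RV P >-> R}).

Definition tail (t : R) : R := pr P [set om | t <= Y om].

Lemma measurable_tail t : measurable [set om | t <= Y om].
Proof. exact: measurable_preimage (measurable_ge t). Qed.

Lemma tail_ge0 t : 0 <= tail t. Proof. exact: pr_ge0. Qed.

Lemma tail_mono s t : s <= t -> tail t <= tail s.
Proof.
move=> st; apply: pr_mono; [exact: measurable_tail|exact: measurable_tail|].
by move=> om /=; exact: le_trans.
Qed.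

Lemma tail_small (e : R) : 0 < e -> exists t, tail t <= e.
Proof.
move=> e0; have : nbhs (0%E : \bar R) [set y : \bar R | (y < e%:E)%E].
  by apply: open_nbhs_nbhs; split; [exact: open_ereal_lt_ereal|rewrite /= lte_fin].
move=> /(@cvg_ccdfy0 _ _ _ P Y)[M [_ /(_ (M + 1))]] /=.
(* One unit goes strictly above [M], the other passes from the weak to the strict tail. *)
rewrite ltrDl ltr01 => /(_ isT) lte; exists (M + 2).
rewrite -lee_fin /tail -prE; last exact: measurable_tail.
apply: le_trans (ltW lte); rewrite /ccdf /distribution /pushforward/=.
apply: le_measure; rewrite ?inE; first exact: measurable_tail.
  by apply: measurable_preimage; exact: measurable_itv.
by move=> om /=; rewrite in_itv/= andbT; apply: lt_le_trans; lra.
Qed.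

Hypotheses (Y_ge0 : forall om, 0 <= Y om)
  (Y_convex : econvex_on [set t : R | 0 <= t] (neg_log_tail Y)).

Lemma tail0 : tail 0 = 1.
Proof.
rewrite /tail -(@pr_setT _ _ _ P); congr (pr P _).
by apply/seteqP; split=> om //= _.
Qed.

(** With [N = - ln tail] and [N 0 = 0], convexity on the segment from 0 to [j * t] gives
    [j * N t <= N (j * t)]. A zero tail, where [N] is infinite, is set apart. *)
Lemma tail_pow (j : nat) t : 0 <= t -> tail (j%:R * t) <= tail t ^+ j.
Proof.
case: j => [|j] t0; first by rewrite mul0r tail0 expr0.
have [tj0|tj0] := eqVneq (tail (j.+1%:R * t)) 0.
  by rewrite tj0 exprn_ge0// tail_ge0.
have pj : 0 < tail (j.+1%:R * t) by rewrite lt_neqAle eq_sym tj0 tail_ge0.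
have pt : 0 < tail t.
  by apply: lt_le_trans pj (tail_mono _); rewrite ler_peMl// ler1n.
have N s : 0 < tail s -> neg_log_tail Y s = (- ln (tail s))%:E.
  move=> ps; rewrite /neg_log_tail prE; last exact: measurable_tail.
  by rewrite -/(tail s) lne_EFin.
have jp : 0 < (j.+1%:R : R) by rewrite ltr0n.
have l01 : 0 <= (j.+1%:R^-1 : R) <= 1.
  by rewrite invr_ge0 ltW//= invf_le1// ler1n.
have jt0 : 0 <= j.+1%:R * t by rewrite mulr_ge0.
have := Y_convex l01 jt0 (lexx 0).
rewrite mulr0 addr0 mulrA mulVf ?gt_eqF// mul1r.
rewrite !N ?tail0// ln1 oppr0 mule0 adde0 -EFinM lee_fin mulrN lerN2.
rewrite ler_pdivrMl// => le1.
rewrite -[leLHS]lnK ?posrE// -[X in X ^+ _]lnK ?posrE// -expRM_natl.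
by rewrite ler_expR.
Qed.

(** The tail may jump across [expR (- 1)], so the quantile is located by doubling [u] until the tail
    first falls to that value. *)
Lemma tail_scale (u : R) : 0 < u -> expR (- 1) <= tail u ->
  exists a, [/\ 0 < a, tail a <= expR (- 1) & expR (- 1) <= tail (a / 4)].
Proof.
move=> u0 pu.
have ex : exists k, tail (u * 2 ^+ k) <= expR (- 1).
  have [t pt] := tail_small (expR_gt0 (- 1)).
  pose k := (Num.truncn (`|t| / u)).+1; exists k.
  apply: le_trans (tail_mono _) pt.
  apply: le_trans (ler_norm t) _; rewrite mulrC -ler_pdivrMr//.
  have : 0 <= `|t| / u by rewrite divr_ge0// ltW.
  move=> /truncn_itv/andP[_ /ltW /le_trans]; apply.
  by rewrite -natrX ler_nat ltnW// ltn_expl.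
have [k pk kmin] := ex_minnP ex.
exists (u * 2 ^+ k); split=> //; first by rewrite mulr_gt0 ?exprn_gt0.
case: k pk kmin => [|k] pk kmin.
  by apply: le_trans pu (tail_mono _); rewrite expr0; lra.
apply: (@le_trans _ _ (tail (u * 2 ^+ k))).
  by rewrite leNgt; apply/negP => /ltW/kmin; rewrite ltnn.
have : 0 < u * 2 ^+ k by rewrite mulr_gt0 ?exprn_gt0.
by move=> uk; apply: tail_mono; rewrite exprS; lra.
Qed.

(** By [tail_pow], [tail u] is at most the [j]-th power of [tail (u / j)], hence at most
    [expR (- j)] for every positive [j]. *)
Lemma null_of_small_tail : (forall u, 0 < u -> tail u < expR (- 1)) ->
  pr P [set om | 0 < Y om] = 0.
Proof.
move=> small.
have small_inv (x : R) (j : nat) : 0 <= x -> x <= expR (- 1) -> x ^+ j <= j.+1%:R^-1.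
  move=> x0 xe; apply: (@le_trans _ _ (expR (- 1) ^+ j)).
    by rewrite lerXn2r ?nnegrE ?expR_ge0.
  rewrite -expRM_natl mulrN mulr1 expRN lef_pV2 ?posrE ?expR_gt0 ?ltr0n//.
  by rewrite -natr1 addrC expR_ge1Dx.
have null u : 0 < u -> tail u = 0.
  move=> u0; apply/eqP; rewrite eq_le tail_ge0 andbT; apply/ler_addgt0Pr => e e0.
  rewrite add0r; pose j := Num.truncn e^-1.
  have le1 : tail u <= (j.+2%:R)^-1.
    have uj : 0 < u / j.+1%:R by rewrite divr_gt0.
    have := tail_pow j.+1 (ltW uj); rewrite mulrCA mulfV ?mulr1 ?gt_eqF//.
    by move=> /le_trans; apply; apply: small_inv; [exact: tail_ge0|exact/ltW/small].
  apply: le_trans le1 _; rewrite -[leRHS]invrK lef_pV2 ?posrE ?invr_gt0//.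
  have /andP[_ /ltW/le_trans] : j%:R <= e^-1 < j.+1%:R.
    by rewrite truncn_itv// invr_ge0 ltW.
  by apply; rewrite ler_nat.
have -> : [set om | 0 < Y om] = \bigcup_k [set om | k.+1%:R^-1 <= Y om].
  apply/seteqP; split=> [om /= Y0|om [k _] /=]; last first.
    by apply: lt_le_trans; rewrite invr_gt0 ltr0n.
  exists (Num.truncn (Y om)^-1) => //=.
  rewrite -[leRHS]invrK lef_pV2 ?posrE ?invr_gt0//.
  by have /andP[_ /ltW] := truncn_itv (ltW (eqbRL (invr_gt0 _) Y0)).
rewrite /pr (_ : P _ = 0%E)//; apply: measure_negligible.
  by apply: bigcup_measurable => k _; exact: measurable_tail.
apply: negligible_bigcup => k; apply/negligibleP; first exact: measurable_tail.
apply: etrans (prE P (measurable_tail k.+1%:R^-1)) _.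
by rewrite -/(tail _) null// invr_gt0.
Qed.

End log_concave_tail.

(** * Degenerate cases of the expected supremum *)

Section expected_sup.
Context {disp : measure_display} {Omega : measurableType disp} {R : realType}.
Variables (P : probability Omega R) (d : nat) (X : 'I_d -> {RV P >-> R}).
Variable T : set 'rV[R]_d.

Lemma dotp_le_sup_dotp x t : T t -> ((dotp x t)%:E <= sup_dotp T x)%E.
Proof. by move=> Tt; apply: ereal_sup_ubound; exists t. Qed.

Lemma expected_sup_set0 : (0 < expected_sup X T)%E -> T !=set0.
Proof.
move=> E0; apply/set0P/eqP => T0; move: E0; apply/negP; rewrite -leNgt.
rewrite /expected_sup.
have -> : (fun om => sup_dotp T (rvec X om)) = fun=> -oo%E.
  by apply/funext => om; rewrite /sup_dotp T0 image_set0 ereal_sup0.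
rewrite integralE (eq_integral (cst 0%E)); last by move=> om _; rewrite funeposE maxNye.
by rewrite integral0 sub0e leeNl oppe0 integral_ge0.
Qed.

Hypotheses (T_ge0 : forall t, T t -> forall i, 0 <= t ord0 i)
  (X_ge0 : forall i om, 0 <= X i om).

Lemma sup_dotp_ge0 om : T !=set0 -> (0 <= sup_dotp T (rvec X om))%E.
Proof.
move=> [t Tt]; apply: le_trans (dotp_le_sup_dotp _ Tt); rewrite lee_fin.
by apply: sumr_ge0 => i _; rewrite mxE mulr_ge0// T_ge0.
Qed.

(** The integral is a supremum over simple functions below the integrand, and each of these vanishes
    off the null set where some [X i] is positive. *)
Lemma expected_sup_null :
  (forall i, pr P [set om | 0 < X i om] = 0) -> (expected_sup X T <= 0)%E.
Proof.
move=> null; rewrite leNgt; apply/negP => E0.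
have Tne := expected_sup_set0 E0.
move: E0; apply/negP; rewrite -leNgt.
rewrite /expected_sup ge0_integralTE; last by move=> om; exact: sup_dotp_ge0.
have mgt i : measurable [set om | 0 < X i om].
  have := measurable_preimage (X i) (measurable_itv `]0, +oo[).
  by congr measurable; apply/seteqP; split=> om /=; rewrite in_itv/= andbT.
pose N := \bigcup_(i in [set: 'I_d]) [set om | 0 < X i om].
have mN : measurable N.
  by apply: fin_bigcup_measurable => [|i _]; [exact: finite_finset|exact: mgt].
have PN : P N = 0%E.
  rewrite prE//; congr (_%:E); apply/eqP; rewrite eq_le pr_ge0 andbT.
  apply: le_trans (pr_union_bound P (Q := xpredT) mN mgt _) _.
    by move=> om [i _ Xi]; exists i.
  by rewrite big1.
apply: ge_ereal_sup => _ [h hle <-]; rewrite -integralT_nnsfun.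
have mh : measurable_fun setT (fun om => (h om)%:E).
  by apply/measurable_EFinP; exact: measurable_funP.
have h0 om : setT om -> (0 <= (h om)%:E)%E by move=> _; rewrite lee_fin.
rewrite (ge0_negligible_integral mN measurableT mh h0 PN).
rewrite integral0_eq// => om [_ Nom].
apply/eqP; rewrite eq_le; apply/andP; split; last by rewrite lee_fin.
apply: le_trans (hle om) _; apply: ge_ereal_sup => _ [t Tt <-].
rewrite lee_fin /dotp big1// => i _; rewrite mxE.
suff -> : X i om = 0 by rewrite mul0r.
apply/eqP; rewrite eq_le X_ge0 andbT leNgt; apply/negP => Xi.
by apply: Nom; exists i.
Qed.

End expected_sup.

(** * Assembling the half-spaces *)

(** Distinct indices may give the same vector, which the set counts once. *)
Lemma esum_image_le (R : realType) (K : finType) (V : choiceType) (Q : pred K)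
    (w : K -> V) (a : V -> \bar R) : (forall x, (0 <= a x)%E) ->
  (\esum_(x in [set w k | k in [set k | Q k]]) a x <= \sum_(k | Q k) a (w k))%E.
Proof.
move=> a0; set F := (X in \esum_(x in X) _).
have finF : finite_set F by apply: finite_image; exact: finite_finset.
rewrite esum_fset// fsbig_finite//=; set s := finmap.enum_fset _.
have us : uniq s by exact: finmap.fset_uniq.
have sF x : (x \in s) = (x \in F) by exact: in_fset_set.
have memF x : x \in s -> F x by rewrite sF inE.
apply: (@le_trans _ _ (\sum_(x <- s) \sum_(k | Q k && (w k == x)) a (w k))%E).
  rewrite big_seq [leRHS]big_seq; apply: lee_sum => x /memF[k Qk <-].
  by rewrite (bigD1 k) ?Qk ?eqxx//= leeDl// sume_ge0.
rewrite (exchange_big_dep Q)/=; last by move=> x k _ /andP[].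
apply: lee_sum => k Qk; under eq_bigl do rewrite Qk/= eq_sym.
have ws : w k \in s by rewrite sF inE; exists k.
by rewrite -big_filter (filter_pred1_uniq us ws) big_seq1.
Qed.

Theorem theorem2p6 (R : realType) :
  exists L : R, 0 < L /\
  forall (d : nat) (T : set 'rV[R]_d)
    (disp : measure_display) (Omega : measurableType disp)
    (P : probability Omega R) (X : 'I_d -> {RV P >-> R}),
    (forall t, T t -> forall i, 0 <= t ord0 i) ->
    (forall i om, 0 <= X i om) ->
    iid X ->
    (forall i, econvex_on [set t : R | 0 <= t] (neg_log_tail (X i))) ->
    (* the claim fails whenever the expected supremum is not in ]0, +oo[ *)
    (0 < expected_sup X T)%E -> (expected_sup X T < +oo)%E ->
    exists G : set 'rV[R]_d,
      [/\ countable G,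
          [set x | (L%:E * expected_sup X T <= sup_dotp T x)%E]
            `<=` \bigcup_(w in G) [set x | 1 <= dotp x w]
        & (\esum_(w in G) P [set om | (1 <= dotp (rvec X om) w)%R]
            <= (2^-1 : R)%:E)%E].
Proof.
(* [B] is the constant of [T_sum]; [K] solves [(K - 1) / 2 - 2 = cover_rate B], the rate in
   [pr_halfspace]. *)
pose B : R := 4 * expR 1; pose K : R := 2 * cover_rate B + 5.
have e2 : 2 <= expR 1 :> R by apply: le_trans (expR_ge1Dx 1).
have B1 : 1 <= B by rewrite /B; lra.
have K1 : 1 <= K by rewrite /K /cover_rate; lra.
(* The factor 2 yields a point [t] beyond half the bound, [K] is the dilation in the half-spaces,
   and [B + 2 * 10] accounts for dyadic rounding. *)
exists (2 * K * (B + 20)); split; first by rewrite mulr_gt0; lra.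
move=> d T disp Omega P X T0 X0 [indX idX] conv E0 Eoo.
have Tne := expected_sup_set0 E0.
have [E EE] : exists E, expected_sup X T = E%:E.
  by exists (fine (expected_sup X T)); rewrite fineK// ge0_fin_numE// ltW.
have E_gt0 : 0 < E by rewrite -lte_fin -EE.
have [i0 [u [u0 pu]]] : exists i u, 0 < u /\ expR (- 1) <= tail (X i) u.
  apply: contrapT => /forallNP H; move: E0; apply/negP; rewrite -leNgt.
  apply: expected_sup_null => // i.
  apply: null_of_small_tail => // v v0.
  by rewrite ltNge; apply/negP => pv; apply: (H i); exists v.
have [a [a0 pa pa4]] := tail_scale u0 pu.
have same i A : measurable A -> pr P (X i @^-1` A) = pr P (X i0 @^-1` A).
  by move=> mA; rewrite /pr; congr fine; exact: idX.
pose p := tail (X i0).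
have tailE i t : tail (X i) t = p t by exact: same (measurable_ge t).
have pow j t : 0 <= t -> p (j%:R * t) <= p t ^+ j by exact: tail_pow.
have p_dyadic k : p (a * 2 ^+ k) <= expR (- 2 ^+ k).
  rewrite mulrC -natrX; apply: le_trans (pow _ _ (ltW a0)) _.
  rewrite -[X in expR (- X)]mulr1 -mulrN expRM_natl.
  by rewrite lerXn2r ?nnegrE ?expR_ge0 ?tail_ge0.
(* The least [n] for which a union bound over single coordinates costs at most 1/4; below it the
   tails are positive, so the costs are finite. *)
have [n pn n_min] : exists2 n, d%:R * p (a * 2 ^+ n) <= 4^-1 &
    forall k, (k < n)%N -> 0 < p (a * 2 ^+ k).
  have ex : exists k, d%:R * p (a * 2 ^+ k) <= 4^-1.
    have dp : 0 < 1 + (4 * d)%:R :> R by rewrite ltr_wpDr.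
    exists (4 * d)%N; apply: (@le_trans _ _ (d%:R * (1 + (4 * d)%:R)^-1)).
      apply: ler_wpM2l => //; apply: le_trans (p_dyadic _) _.
      rewrite expRN lef_pV2 ?posrE ?expR_gt0//.
      apply: le_trans (expR_ge1Dx _); rewrite lerD2l -natrX ler_nat.
      by rewrite ltnW// ltn_expl.
    by rewrite ler_pdivrMr// natrM; lra.
  have [n pn nmin] := ex_minnP ex; exists n => // k kn.
  rewrite lt_neqAle eq_sym tail_ge0 andbT; apply/eqP => pk.
  by have := nmin k; rewrite pk mulr0 invr_ge0// => /(_ (ler0n _ _)); rewrite leqNgt kn.
pose val := @level_value R n a.
pose cost l := if l == ord0 then 0 else - ln (p (val l)).
have valE l : l != ord0 -> val l = a * 2 ^+ l.-1.
  by rewrite /val /level_value => /negbTE ->.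
have lpred (l : 'I_n.+1) : l != ord0 -> (l.-1 < n)%N.
  by case: l => -[|m].
have pval_gt0 l : l != ord0 -> 0 < p (val l).
  by move=> l0; rewrite valE// n_min// lpred.
have costE l : l != ord0 -> expR (- cost l) = p (val l).
  by move=> l0; rewrite /cost (negbTE l0) opprK lnK// posrE pval_gt0.
have cost_ge l : l != ord0 -> 2 ^+ l.-1 <= cost l.
  by move=> l0; rewrite -lerN2 -ler_expR costE// valE// p_dyadic.
have cost1 l : l != ord0 -> 1 <= cost l.
  by move=> /cost_ge; apply: le_trans; rewrite exprn_ege1// ler1n.
have cost0 : cost ord0 = 0 by rewrite /cost eqxx.
have val0 : val ord0 = 0 by exact: level_value0.
have val_ge0 l : 0 <= val l by exact: level_value_ge0.
pose lev i om := level n a (X i om).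
have mlev i l : measurable [set om | lev i om = l].
  exact: (measurable_preimage (X i) (measurable_level a0 l)).
pose mu l := pr P [set om | lev i0 om = l].
have muE i l : pr P [set om | lev i om = l] = mu l.
  exact: (same i _ (measurable_level a0 l)).
have mu_sum : \sum_l mu l = 1.
  apply: EFin_inj; rewrite -(eq_bigr _ (fun l _ => mul1r (mu l))).
  rewrite -(integral_finite_mixture P xpredT)//.
  under eq_integral => om _.
    rewrite (bigD1 (lev i0 om))//= indicE mem_set// mulr1 big1 ?addr0.
      over.
    move=> l /eqP ln; rewrite indicE memNset ?mulr0//= => h; exact: ln.
  by rewrite integral_cst// mul1e; exact: probability_setT.
(* From [p v <= mu l + p (2 * v)], [p (2 * v) <= p v ^+ 2] and [p v <= 1/2], the mass is at least
   [p v ^+ 2]. *)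
have mu_ge l : l != ord0 -> expR (- (2 * cost l)) <= mu l.
  move=> l0; set v := val l; have v0 : 0 < v by exact: level_value_gt0.
  have le1 : p v <= mu l + p (2 * v).
    pose A (b : bool) := if b then [set om | lev i0 om = l] else [set om | 2 * v <= X i0 om].
    have -> : mu l + p (2 * v) = \sum_b pr P (A b) by rewrite big_bool.
    apply: pr_union_bound; first exact: measurable_tail.
      by case; [exact: mlev|exact: measurable_tail].
    move=> om /= vX; case: (leP (2 * v) (X i0 om)) => [le2|lt2]; first by exists false.
    exists true => //=; apply/levelP => //; rewrite -/val -/v vX orbT/=.
    rewrite (_ : a * 2 ^+ l = 2 * v) ?lt2 ?orbT// /v valE// mulrCA -exprS prednK// lt0n //.
  have le2 := pow 2 v (ltW v0).
  have le3 : p v <= expR (- 1).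
    by rewrite /v -costE// ler_expR lerN2 cost1.
  have le4 : expR (- 1) <= 2^-1 :> R.
    by rewrite expRN lef_pV2 ?posrE ?expR_gt0.
  have le5 := tail_ge0 (X i0) v.
  have -> : expR (- (2 * cost l)) = p v ^+ 2.
    by rewrite -mulrN expRM_natl costE.
  move: le1 le2 le3 le5; rewrite -/p; nra.
(* Each [X i] is bounded below by [a / 4] on an event of probability at least [expR (- 1)]. *)
have T_sum t : T t -> a * (\sum_i t ord0 i) <= B * E.
  move=> Tt.
  have : ((\sum_(i < d) (t ord0 i * (a / 4)) * pr P [set om | a / 4 <= X i om])%:E
      <= expected_sup X T)%E.
    apply: finite_mixture_le_integral => [i|i|om]; last first.
    - apply: le_trans (dotp_le_sup_dotp _ Tt); rewrite lee_fin.
      apply: ler_sum => i _; rewrite mxE [leRHS]mulrC -mulrA.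
      apply: ler_wpM2l; rewrite ?T0// indicE.
      by case: (boolP (om \in _)) => [/set_mem/=|_]; rewrite ?mulr1 ?mulr0.
    - exact: measurable_tail.
    - by rewrite mulr_ge0 ?T0//; lra.
  rewrite EE lee_fin => le1.
  have le2 : (\sum_i t ord0 i) * (a / 4) * expR (- 1) <= E.
    apply: le_trans le1; rewrite !mulr_suml; apply: ler_sum => i _.
    rewrite ler_wpM2l ?mulr_ge0 ?T0//; first by lra.
    by rewrite -/(tail (X i) _) tailE.
  move: le2; rewrite expRN ler_pdivrMr ?expR_gt0// /B.
  lra.
pose T' := [set (fun i => t ord0 i / E) | t in T].
have T'_ge0 t : T' t -> forall i, 0 <= t i.
  by move=> [s Ts <-] i; rewrite divr_ge0 ?T0// ltW.
have T'_bound t : T' t -> forall i l, t i * val l <= B * cost l.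
  move=> [s Ts <-] i l; have [->|l0] := eqVneq l ord0.
    by rewrite val0 cost0 !mulr0.
  have le1 : a * s ord0 i <= B * E.
    apply: le_trans (T_sum _ Ts); rewrite ler_wpM2l ?(ltW a0)//.
    by rewrite (bigD1 i)//= lerDl sumr_ge0// => k _; exact: T0.
  rewrite valE// [leLHS]mulrA; apply: ler_pM; rewrite ?exprn_ge0 ?cost_ge//.
    by rewrite mulr_ge0 ?(ltW a0)// divr_ge0 ?T0// ltW.
  by rewrite mulrAC ler_pdivrMr// mulrC.
pose good (W : {ffun 'I_d -> 'I_n.+1}) : bool :=
  `[< forall t, T t -> \sum_i t ord0 i * val (W i) <= 4 * E >].
have weightE t (z : {ffun 'I_d -> 'I_n.+1}) :
    weight val (fun i => t ord0 i / E) z = (\sum_i t ord0 i * val (z i)) / E.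
  by rewrite mulr_suml; apply: eq_bigr => i _; rewrite mulrAC.
have good_le W t : good W -> T' t -> weight val t W <= 4.
  by move=> /asboolP gW [s Ts <-]; rewrite weightE ler_pdivrMr// gW.
have good_mass : 3 / 4 <= \sum_(W : {ffun 'I_d -> 'I_n.+1} | good W) \prod_i mu (W i).
  pose box (W : {ffun 'I_d -> 'I_n.+1}) := [set om | forall i, lev i om = W i].
  have mbox W : measurable (box W).
    exact: (measurable_box X (fun i => measurable_level a0 (W i))).
  have prbox W : pr P (box W) = \prod_i mu (W i).
    rewrite (pr_box indX (fun i => measurable_level a0 (W i))).
    by apply: eq_bigr => i _; exact: muE.
  (* Markov: on the disjoint bad boxes the supremum is at least [4 * E]. *)
  have : ((\sum_(W | ~~ good W) (4 * E) * pr P (box W))%:E <= expected_sup X T)%E.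
    apply: finite_mixture_le_integral => // [W|om]; first by rewrite mulr_ge0// ltW.
    pose W0 : {ffun 'I_d -> 'I_n.+1} := [ffun i => lev i om].
    have other W : W != W0 -> \1_(box W) om = 0 :> R.
      move=> /eqP WW0; rewrite indicE memNset//= => h; apply: WW0.
      by apply/ffunP => i; rewrite ffunE h.
    have [gW0|bW0] := boolP (good W0).
      rewrite big1; first exact: sup_dotp_ge0.
      move=> W bW; rewrite other ?mulr0//.
      by apply: contraNneq bW => ->.
    rewrite (bigD1 W0)//= big1 ?addr0; last by move=> W /andP[_ /other ->]; rewrite mulr0.
    rewrite indicE mem_set ?mulr1; last by move=> i /=; rewrite ffunE.
    move: bW0 => /asboolP/existsNP[t /not_implyP[Tt]] /negP; rewrite -ltNge => lt4.
    apply: le_trans (dotp_le_sup_dotp _ Tt); rewrite lee_fin.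
    apply: le_trans (ltW lt4) _; apply: ler_sum => i _.
    by rewrite mxE mulrC ler_wpM2r ?T0// ffunE level_value_le.
  rewrite EE lee_fin -mulr_sumr.
  rewrite (eq_bigr (fun W : {ffun 'I_d -> 'I_n.+1} => \prod_i mu (W i)))// => le1.
  move: le1; set b := \sum_(W | ~~ good W) _ => le1.
  have : b <= 4^-1.
    rewrite -(ler_pM2l (_ : 0 < 4 * E)); last by rewrite mulr_gt0.
    by apply: le_trans le1 _; lra.
  have := @sum_pattern_mass R d n mu mu_sum; rewrite (bigID good)/= -/b.
  lra.
have mu_ge0 l : 0 <= mu l by exact: pr_ge0.
have T'ne : T' !=set0 by case: Tne => t Tt; exists (fun i => t ord0 i / E), t.
have [G [coverG costG sumG]] := pattern_cover B1 val0 cost0 cost1 val_ge0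
  T'_ge0 T'_bound mu_ge0 mu_sum mu_ge T'ne good_le good_mass.
have top_gt0 : 0 < a * 2 ^+ n by rewrite mulr_gt0 ?exprn_gt0.
(* The vector of a pattern [r] is at least 1 on points above [K * val (r i)] on its support; those
   of single coordinates catch points beyond the top threshold. *)
pose w (k : {ffun 'I_d -> 'I_n.+1} + 'I_d) : 'rV[R]_d :=
  match k with
  | inl r => \row_i (cost (r i) / (K * val (r i) * \sum_k cost (r k)))
  | inr i => \row_k (if k == i then (a * 2 ^+ n)^-1 else 0)
  end.
pose Q (k : {ffun 'I_d -> 'I_n.+1} + 'I_d) := if k is inl r then G r else true.
have dotp_inr x i : dotp x (w (inr i)) = x ord0 i / (a * 2 ^+ n).
  rewrite /dotp (bigD1 i)//= big1 ?addr0 ?mxE ?eqxx// => k /negbTE ki.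
  by rewrite !mxE ki mulr0.
exists [set w k | k in [set k | Q k]]; split.
- by apply: finite_set_countable; apply: finite_image; exact: finite_finset.
- move=> x /= supx.
  have [t Tt xt] : exists2 t, T t & K * (B + 20) * E < dotp x t.
    apply: contrapT => H; have : (sup_dotp T x <= (K * (B + 20) * E)%:E)%E.
      apply: ge_ereal_sup => _ [t Tt <-]; rewrite lee_fin leNgt; apply/negP => xt.
      by apply: H; exists t.
    apply/negP; rewrite -ltNge; apply: lt_le_trans supx.
    rewrite EE -EFinM lte_fin ltr_pM2r//.
    have : 0 < K * (B + 20) by rewrite mulr_gt0; lra.
    by lra.
  have [[i xi]|small] := pselect (exists i, a * 2 ^+ n <= x ord0 i / K).
    exists (w (inr i)); first by exists (inr i).
    have Kp : 0 < K by lra.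
    rewrite /= dotp_inr ler_pdivlMr// mul1r; apply: (le_trans xi).
    rewrite ler_pdivrMr// ler_peMr//.
    by have := lt_le_trans top_gt0 xi; rewrite pmulr_lgt0 ?invr_gt0// => /ltW.
  pose s : {ffun 'I_d -> 'I_n.+1} := [ffun i => level n a (x ord0 i / K)].
  have s_ge : 10 <= weight val (fun i => t ord0 i / E) s.
    rewrite weightE ler_pdivlMr// leNgt; apply/negP => lt10.
    move: xt; apply/negP; rewrite -leNgt.
    (* Below the top threshold, [x ord0 i / K] is less than [a] at level 0 and less than twice its
       rounded value at other levels. *)
    apply: (@le_trans _ _ (\sum_i K * ((a + 2 * val (s i)) * t ord0 i))).
      apply: ler_sum => i _; rewrite mulrA ler_wpM2r ?T0//.
      rewrite mulrC -ler_pdivrMr; last by lra.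
      have xn : x ord0 i / K < a * 2 ^+ n.
        by rewrite ltNge; apply/negP => h; apply: small; exists i.
      apply: le_trans (ltW (level_lt_top xn)) _; rewrite ffunE.
      set l := level _ _ _; have [->|l0] := eqVneq l ord0.
        by rewrite expr0 val0; lra.
      rewrite valE// mulrCA -exprS prednK ?lt0n//; lra.
    rewrite -mulr_sumr -mulrA ler_wpM2l//; first by lra.
    rewrite (eq_bigr (fun i => a * t ord0 i + 2 * (t ord0 i * val (s i)))); last first.
      by move=> i _; ring.
    rewrite big_split/= -!mulr_sumr; have := T_sum _ Tt; lra.
  have [r Gr rs] := coverG s _ (imageP _ Tt) s_ge.
  exists (w (inl r)); first by exists (inl r).
  have N0 := costG r Gr; rewrite /= /dotp.
  have {1}<- : (\sum_i cost (r i)) / (\sum_k cost (r k)) = 1.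
    by rewrite divff// gt_eqF.
  rewrite mulr_suml; apply: ler_sum => i _; rewrite mxE.
  have [->|ri] := eqVneq (r i) ord0; first by rewrite cost0 !(mul0r, mulr0).
  have vr : 0 < val (r i) by exact: level_value_gt0.
  have xr : val (r i) <= x ord0 i / K.
    have /forallP/(_ i) := rs; rewrite (negbTE ri)/= ffunE => /eqP/esym/(levelP a0).
    by rewrite (negbTE ri)/= => /andP[].
  have Kp : 0 < K by lra.
  have -> : x ord0 i * (cost (r i) / (K * val (r i) * \sum_k cost (r k))) =
      cost (r i) / (\sum_k cost (r k)) * (x ord0 i / K / val (r i)).
    by field; rewrite !gt_eqF.
  rewrite ler_peMr//; last by rewrite ler_pdivlMr// mul1r.
  by rewrite divr_ge0 ?(ltW N0)// (le_trans ler01)// cost1.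
- apply: le_trans (esum_image_le _ _ _) _ => //.
  rewrite (eq_bigr (fun k => (pr P [set om | 1 <= dotp (rvec X om) (w k)])%:E)); last first.
    by move=> k _; rewrite prE//; exact: measurable_halfspace.
  rewrite sumEFin lee_fin big_sumType/=.
  (* One quarter for the patterns, one for the single coordinates. *)
  have -> : 2^-1 = 4^-1 + 4^-1 :> R by lra.
  apply: lerD.
    apply: le_trans sumG; apply: ler_sum => r Gr.
    have -> : cover_rate B = (K - 1) / 2 - 2 by rewrite /K; lra.
    apply: pr_halfspace => // [i|i j ci|]; last exact: costG.
      have [->|ri] := eqVneq (r i) ord0; first by left.
      by right; split; [exact: cost1|exact: level_value_gt0].
    have ri : r i != ord0 by apply: contraNneq ci => ->; rewrite cost0.
    rewrite -/(tail (X i) _) tailE; apply: le_trans (pow _ _ (val_ge0 _)) _.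
    by rewrite mulrC -mulrN expRM_natl costE.
  apply: le_trans pn; rewrite -[X in X%:R * _]card_ord -sumr_const mulr_suml.
  apply: ler_sum => i _; rewrite mul1r -(tailE i).
  apply: pr_mono; [exact: measurable_halfspace|exact: measurable_tail|].
  by move=> om /=; rewrite dotp_inr mxE ler_pdivlMr// mul1r.
Qed.
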